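(* Let $X$ and $Y$ be real Banach spaces and $1<p<\infty$. If $X$ and $Y$ are octahedral, then $X\oplus_p Y$ is $2^{1-1/p}$-average rough.
   Context: For a Banach space $X$, $S_X$ denotes its unit sphere. A real Banach space $X$ is octahedral if for every finite-dimensional subspace $E$ of $X$ and every $\varepsilon>0$ there is a norm one element $y\in X$ such that $\|x+y\|\geq(1-\varepsilon)(\|x\|+\|y\|)$ for all $x\in E$. For $\delta>0$, a Banach space $X$ is $\delta$-average rough if, whenever $n\in\mathbb{N}$ ($n\ge 1$) and $x_1,\dots,x_n\in S_X$, $$\limsup_{\|y\|\to 0}\frac1n\sum_{i=1}^n\frac{\|x_i+y\|+\|x_i-y\|-2}{\|y\|}\geq\delta,$$ where $y$ ranges over nonzero elements of $X$. $X\oplus_p Y$ is $X\times Y$ with the norm $\|(x,y)\|_p=(\|x\|^p+\|y\|^p)^{1/p}$. *)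

(* Defs.v *)
From HB Require Import structures.
From mathcomp Require Import all_boot all_order all_algebra.
From mathcomp Require Import all_classical all_reals all_analysis.

Set Implicit Arguments.
Unset Strict Implicit.
Unset Printing Implicit Defensive.

Import Order.TTheory GRing.Theory Num.Theory.
Import numFieldNormedType.Exports.

Local Open Scope classical_set_scope.
Local Open Scope ring_scope.

Definition finite_dim_subspace (R : realType) (X : normedModType R)
    (E : set X) : Prop :=
  exists (n : nat) (e : 'I_n -> X),
    E = range (fun a : 'I_n -> R => \sum_(i < n) a i *: e i).

Definition octahedral (R : realType) (X : completeNormedModType R) : Prop :=
  forall (E : set X) (eps : R), finite_dim_subspace E -> 0 < eps ->
  exists y : X, `|y| = 1 /\
    forall x : X, E x -> (1 - eps) * (`|x| + `|y|) <= `|x + y|.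

Definition rough_quotient (R : realType) (X : normedModType R) (n : nat)
    (x : 'I_n -> X) (y : X) : R :=
  n%:R^-1 * \sum_(i < n) ((`|x i + y| + `|x i - y| - 2) / `|y|).

(* 0^' is the filter of punctured neighbourhoods of 0, so y ranges over nonzero
   vectors; the upper limit is taken in the extended reals. *)
Definition average_rough (R : realType) (delta : R)
    (X : completeNormedModType R) : Prop :=
  forall (n : nat) (x : 'I_n -> X), (0 < n)%N -> (forall i, `|x i| = 1) ->
  (delta%:E <= limf_esup (fun y : X => (rough_quotient x y)%:E) (0%R : X)^')%E.

Section pnorm.
Context {R : realType} (p : R) (X Y : normedModType R) (p1 : 1 < p).
Implicit Types z w : X * Y.

Definition pnorm z : R := (`|z.1| `^ p + `|z.2| `^ p) `^ p^-1.

Let p0 : 0 < p. Proof. exact: lt_trans p1. Qed.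

Lemma pnorm_ge0 z : 0 <= pnorm z. Proof. exact: powR_ge0. Qed.

Lemma pnorm_powR z : pnorm z `^ p = `|z.1| `^ p + `|z.2| `^ p.
Proof.
rewrite /pnorm -powRrM mulVf ?gt_eqF// powRr1// addr_ge0 ?powR_ge0//.
Qed.

Lemma pnormZ (l : R) z : pnorm (l *: z) = `|l| * pnorm z.
Proof.
rewrite /pnorm/= !normrZ !powRM// -mulrDr powRM ?addr_ge0 ?powR_ge0//.
by rewrite -powRrM mulfV ?gt_eqF// powRr1.
Qed.

Lemma ler_fst_pnorm z : `|z.1| <= pnorm z.
Proof.
rewrite -[leLHS](@powRr1 _ `|z.1|)// -(@mulfV _ p) ?gt_eqF// powRrM.
by apply: ge0_ler_powR;
  rewrite ?invr_ge0 ?nnegrE ?lerDl ?addr_ge0 ?powR_ge0//; exact: ltW.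
Qed.

Lemma ler_snd_pnorm z : `|z.2| <= pnorm z.
Proof.
rewrite -[leLHS](@powRr1 _ `|z.2|)// -(@mulfV _ p) ?gt_eqF// powRrM.
by apply: ge0_ler_powR;
  rewrite ?invr_ge0 ?nnegrE ?lerDr ?addr_ge0 ?powR_ge0//; exact: ltW.
Qed.

Lemma pnorm_eq0 z : pnorm z = 0 -> z = 0.
Proof.
move=> z0; have := ler_fst_pnorm z; have := ler_snd_pnorm z.
rewrite z0 !normr_le0 => /eqP z2 /eqP z1.
by rewrite [z]surjective_pairing z1 z2.
Qed.

Lemma ler_pnormD z w : pnorm (z + w) <= pnorm z + pnorm w.
Proof.
have [q0 pq] : 0 < (p / (p - 1)) /\ p^-1 + (p / (p - 1))^-1 = 1.
  split; first by rewrite divr_gt0// subr_gt0.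
  by rewrite invf_div -{1}(div1r p) -mulrDl subrKC mulfV// gt_eqF.
set q := p / (p - 1) in q0 pq.
have pNq : (p - 1) * q = p by rewrite /q mulrC divfK// subr_eq0 gt_eqF.
set S := pnorm (z + w); set s := z.1 + w.1; set t := z.2 + w.2.
have := pnorm_ge0 (z + w); rewrite le_eqVlt => /predU1P[S0|S0].
  by rewrite /S -S0 addr_ge0// pnorm_ge0.
have SE : (`|s| `^ p + `|t| `^ p) `^ q^-1 = S `^ (p - 1).
  by rewrite /S /pnorm -powRrM /q invf_div mulrC.
have H u : `|u.1| * `|s| `^ (p - 1) + `|u.2| * `|t| `^ (p - 1) <=
    pnorm u * S `^ (p - 1).
  have := @hoelder2 _ `|u.1| `|u.2| (`|s| `^ (p - 1)) (`|t| `^ (p - 1)) p q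
    (normr_ge0 _) (normr_ge0 _) (powR_ge0 _ _) (powR_ge0 _ _) p0 q0 pq.
  by rewrite -(powRrM `|s|) -(powRrM `|t|) pNq SE.
have E : S `^ p <= (pnorm z + pnorm w) * S `^ (p - 1).
  rewrite pnorm_powR -/s -/t mulrDl.
  apply: le_trans _ (lerD (H z) (H w)).
  rewrite addrACA -!mulrDl -[`|s| `^ p]mulr_powRB1//.
  rewrite -[`|t| `^ p]mulr_powRB1// lerD// ler_wpM2r ?powR_ge0// ler_normD//.
by move: E; rewrite -(mulr_powRB1 (ltW S0) p0) ler_pM2r// powR_gt0.
Qed.

Lemma pnorm_le z : pnorm z <= `|z.1| + `|z.2|.
Proof.
have pN0 : p != 0 by rewrite gt_eqF.
rewrite [z in leLHS](_ : z = (z.1, 0) + (0, z.2)); last first.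
  by rewrite -[LHS]addr0 [z]surjective_pairing; congr pair; rewrite ?addr0 ?add0r.
apply: le_trans (ler_pnormD _ _) _.
rewrite /pnorm/= !normr0 !powR0// addr0 add0r.
by rewrite -!powRrM mulfV// !powRr1.
Qed.

End pnorm.

(* psum p1 X Y is an alias of X * Y carrying the norm pnorm p instead of the
   library's supremum norm; the proof p1 is a parameter of the type because the
   triangle inequality needs it. *)
Definition psum (R : realType) (p : R) (p1 : 1 < p)
  (X Y : completeNormedModType R) : Type := (X * Y)%type.

Section psum.
Context {R : realType} (p : R) (p1 : 1 < p) (X Y : completeNormedModType R).

HB.instance Definition _ := GRing.Lmodule.copy (psum p1 X Y) (X * Y)%type.

HB.instance Definition _ := @Lmodule_isNormed.Build R (psum p1 X Y)
  (@pnorm R p X Y) (ler_pnormD p1) (pnormZ p1) (pnorm_eq0 p1).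

Lemma psum_complete (F : set_system (psum p1 X Y)) :
  ProperFilter F -> cauchy F -> cvg F.
Proof.
move=> FF /cauchyP Fc.
have c1 : cvg (@fst X Y @ F).
  apply: cauchy_cvg; apply: cauchy_exP => e /Fc[z Fz]; exists z.1.
  change (F (@fst X Y @^-1` ball z.1 e)).
  apply: filterS Fz => w; rewrite -!ball_normE /=.
  by apply: le_lt_trans; exact: (ler_fst_pnorm p1 (z - w : X * Y)).
have c2 : cvg (@snd X Y @ F).
  apply: cauchy_cvg; apply: cauchy_exP => e /Fc[z Fz]; exists z.2.
  change (F (@snd X Y @^-1` ball z.2 e)).
  apply: filterS Fz => w; rewrite -!ball_normE /=.
  by apply: le_lt_trans; exact: (ler_snd_pnorm p1 (z - w : X * Y)).
apply/cvg_ex; exists ((lim (@fst X Y @ F), lim (@snd X Y @ F)) : psum p1 X Y).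
apply/cvgrPdist_lt => e e0.
have e20 : 0 < e / 2 by rewrite divr_gt0.
near=> w.
rewrite [e]splitr; apply: le_lt_trans (pnorm_le p1 _) _.
by apply: ltrD => /=; near: w;
  [exact: cvgr_dist_lt c1 _ e20|exact: cvgr_dist_lt c2 _ e20].
Unshelve. all: by end_near. Qed.

HB.instance Definition _ := Uniform_isComplete.Build (psum p1 X Y)
  psum_complete.

Lemma psum_normE (z : psum p1 X Y) :
  `|z| = (`|z.1| `^ p + `|z.2| `^ p) `^ p^-1.
Proof. by []. Qed.

End psum.

(* Main.v *)
Require Import Defs.
From mathcomp Require Import all_boot all_order all_algebra.
From mathcomp Require Import all_classical all_reals all_analysis.
From mathcomp Require Import ring lra.

Import Order.TTheory GRing.Theory Num.Theory.
Import numFieldNormedType.Exports.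

Local Open Scope ring_scope.

(** Given unit vectors [z_i = (x_i, y_i)] of the [p]-sum, octahedrality of the
    summands provides unit vectors [u] and [v] that are almost [l1]-orthogonal
    to the spans of the [x_i] and of the [y_i].  With [a = 2 `^ (- p^-1)] the
    vector [w = (a u, a v)] is a unit vector, and moving from [z_i] by [s w] or
    by [- s w] lengthens both coordinates by almost [s a].  The derivative of
    the [p]-norm at [(|x_i|, |y_i|)] is the functional with coefficients
    [|x_i| `^ (p - 1)] and [|y_i| `^ (p - 1)]; it has dual norm 1
    ([pnorm_support]), so it bounds [|z_i + s w|] and [|z_i - s w|] from below
    by almost [1 + s a (|x_i| `^ (p - 1) + |y_i| `^ (p - 1))].  The last bracket
    is at least [|x_i| `^ p + |y_i| `^ p = 1], because both coordinates have
    norm at most 1.  Hence each of the [n] quotients is almost at least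
    [2 a = 2 `^ (1 - p^-1)].

    The estimate holds for every step [s > 0], with an error that the
    octahedrality constant makes as small as desired compared with [s]; this is
    why no limit in [s] is taken and why [average_rough_criterion] is enough. *)

(** * Octahedrality along rays, and a criterion for average roughness *)

(** In the definition of octahedrality [y] has norm one, whereas the point [x]
    is arbitrary in a subspace; by homogeneity, [y] may be rescaled by any
    [t > 0], and the symmetry of the subspace allows the opposite sign. *)
Lemma octahedral_family {R : realType} {X : completeNormedModType R}
    (hX : octahedral X) {n : nat} (e : 'I_n -> X) {eps : R} : 0 < eps ->
  exists u : X, `|u| = 1 /\ forall i (t : R), 0 < t ->
    (1 - eps) * (`|e i| + t) <= `|e i + t *: u| /\
    (1 - eps) * (`|e i| + t) <= `|e i - t *: u|.
Proof.
move=> eps0.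
pose E := range (fun a : 'I_n -> R => \sum_(i < n) a i *: e i).
have EZ i (c : R) : E (c *: e i).
  exists (fun j => if j == i then c else 0) => //=.
  rewrite (bigD1 i)//= eqxx big1 ?addr0// => j /negbTE ->.
  by rewrite scale0r.
have [|u [u1 hu]] := hX E eps _ eps0; first by exists n, e.
exists u; split=> // i t t0.
have tN0 : t != 0 by rewrite gt_eqF.
have scale (x : X) : E (t^-1 *: x) ->
    (1 - eps) * (`|x| + t) <= `|x + t *: u|.
  move=> /hu; rewrite u1 normrZ gtr0_norm ?invr_gt0// => H.
  have -> : x + t *: u = t *: (t^-1 *: x + u).
    by rewrite scalerDr scalerA mulfV// scale1r.
  rewrite normrZ gtr0_norm//; move: H; rewrite -(ler_pM2l t0).
  apply: le_trans; rewrite le_eqVlt; apply/orP; left; apply/eqP.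
  by field.
split; first exact/scale/EZ.
rewrite -[`|e i - _|]normrN opprB -[`|e i|]normrN [t *: u - _]addrC; apply: scale.
by rewrite scalerN -scaleNr; exact: EZ.
Qed.

(** Every punctured neighbourhood of 0 contains a whole sphere of some radius
    [s], so one vector [s *: w] on each small sphere bounds all the suprema in
    the upper limit; the direction [w] may depend on [s] and on the error [eta],
    as it does for octahedral spaces. *)
Lemma average_rough_criterion (R : realType) (Z : completeNormedModType R)
    (delta : R) :
  (forall n (x : 'I_n -> Z) (s eta : R), (forall i, `|x i| = 1) ->
     0 < s -> 0 < eta ->
     exists w : Z, `|w| = 1 /\ forall i,
       2 + s * (delta - eta) <= `|x i + s *: w| + `|x i - s *: w|) ->
  average_rough delta Z.
Proof.
move=> H n x n0 x1; apply: le_ereal_inf_tmp => _ [V V0 <-].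
apply/lee_subgt0Pr => eta eta0.
move: V0 => /nbhs_normP[r /= r0 rV].
have s0 : 0 < r / 2 by rewrite divr_gt0.
have [w [w1 hw]] := H n x _ _ x1 s0 eta0.
set s := r / 2 in s0 hw.
have sw : `|s *: w| = s by rewrite normrZ w1 mulr1 gtr0_norm.
apply: (@le_trans _ _ (rough_quotient x (s *: w))%:E); last first.
  apply: ereal_sup_ubound; exists (s *: w) => //; apply: rV => /=.
    by rewrite sub0r normrN sw /s; lra.
  by rewrite -normr_eq0 sw gt_eqF.
rewrite -EFinB lee_fin /rough_quotient sw.
rewrite ler_pdivlMl ?ltr0n// mulr_natl.
rewrite -{1}[n]card_ord -sumr_const; apply: ler_sum => i _.
by rewrite ler_pdivlMr// lerBrDl mulrC.
Qed.

(** * The dual functional of the p-norm at a unit vector *)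

(** Hölder: the functional with coefficients [|z.i| `^ (p - 1)] has norm
    [pnorm p z `^ (p - 1)] in the dual [q]-norm, as [(p - 1) * q = p]. *)
Lemma pnorm_support {R : realType} {p : R} {X Y : normedModType R}
    (p1 : 1 < p) {z : X * Y} (w : X * Y) : pnorm p z = 1 ->
  `|w.1| * `|z.1| `^ (p - 1) + `|w.2| * `|z.2| `^ (p - 1) <= pnorm p w.
Proof.
move=> z1; have p0 : 0 < p by exact: lt_trans p1.
pose q := p / (p - 1).
have q0 : 0 < q by rewrite divr_gt0// subr_gt0.
have pq : p^-1 + q^-1 = 1.
  by rewrite /q invf_div -{1}(div1r p) -mulrDl subrKC mulfV// gt_eqF.
have pNq : (p - 1) * q = p by rewrite /q mulrC divfK// subr_eq0 gt_eqF.
have := @hoelder2 _ `|w.1| `|w.2| (`|z.1| `^ (p - 1)) (`|z.2| `^ (p - 1)) p q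
  (normr_ge0 _) (normr_ge0 _) (powR_ge0 _ _) (powR_ge0 _ _) p0 q0 pq.
by rewrite -(powRrM `|z.1|) -(powRrM `|z.2|) pNq -(pnorm_powR p1 z) z1 !powR1 mulr1.
Qed.

Lemma powR_le_powRB1 (R : realType) (p a : R) : 0 < p -> 0 <= a -> a <= 1 ->
  a `^ p <= a `^ (p - 1).
Proof.
by move=> p0 a0 a1; rewrite -(mulr_powRB1 a0 p0) ler_piMl// powR_ge0.
Qed.

(** Since the coordinates of a unit vector are at most 1, lowering the exponent
    from [p] to [p - 1] in [|z.1| `^ p + |z.2| `^ p = 1] increases the sum. *)
Lemma pnorm_support_ge1 {R : realType} {p : R} {X Y : normedModType R}
    (p1 : 1 < p) {z : X * Y} : pnorm p z = 1 ->
  1 <= `|z.1| `^ (p - 1) + `|z.2| `^ (p - 1).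
Proof.
move=> z1; have p0 : 0 < p by exact: lt_trans p1.
have := pnorm_powR p1 z; rewrite z1 powR1 => E; rewrite [leLHS]E.
by apply: lerD; apply: powR_le_powRB1 => //; rewrite -z1;
  [exact: ler_fst_pnorm|exact: ler_snd_pnorm].
Qed.

(** * The p-sum *)

(** The functional of [pnorm_support] takes the value [|z.1| `^ p + |z.2| `^ p]
    = 1 at [(|z.1|, |z.2|)] and, by [pnorm_support_ge1], at least [t] at
    [(t, t)]; being linear with nonnegative coefficients, it turns the bounds on
    the two coordinates into one on the norm. *)
Lemma pnorm_increment {R : realType} {p : R} {X Y : normedModType R}
    (p1 : 1 < p) {z w : X * Y} {t eps : R} : pnorm p z = 1 ->
  0 <= t -> eps <= 1 ->
  (1 - eps) * (`|z.1| + t) <= `|w.1| -> (1 - eps) * (`|z.2| + t) <= `|w.2| ->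
  (1 - eps) * (1 + t) <= pnorm p w.
Proof.
move=> z1 t0 eps1 h1 h2; have p0 : 0 < p by exact: lt_trans p1.
apply: le_trans (pnorm_support p1 w z1).
have g1 := pnorm_support_ge1 p1 z1.
have := pnorm_powR p1 z; rewrite z1 powR1.
rewrite -[`|z.1| `^ p]mulr_powRB1// -[`|z.2| `^ p]mulr_powRB1//.
have := ler_wpM2r (powR_ge0 `|z.1| (p - 1)) h1.
have := ler_wpM2r (powR_ge0 `|z.2| (p - 1)) h2.
move: g1; set A := `|z.1| `^ _; set B := `|z.2| `^ _ => g1 hB hA E.
apply: le_trans (lerD hA hB).
rewrite -!mulrA -mulrDr ler_wpM2l ?subr_ge0//.
have := ler_wpM2l t0 g1; lra.
Qed.

Theorem corollary2p6 (R : realType) (X Y : completeNormedModType R)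
    (p : R) (p1 : 1 < p) (hX : octahedral X) (hY : octahedral Y) :
  average_rough (2 `^ (1 - p^-1)) (psum p1 X Y).
Proof.
have p0 : 0 < p by exact: lt_trans p1.
pose a : R := 2 `^ (- p^-1).
have a0 : 0 < a by exact: powR_gt0.
have ap : a `^ p = 2^-1.
  by rewrite /a -powRrM mulNr mulVf ?gt_eqF// powR_inv1.
have -> : 2 `^ (1 - p^-1) = 2 * a.
  by rewrite powRD ?powRr1// pnatr_eq0 implybT.
apply: average_rough_criterion => n z s eta z1 s0 eta0.
have sa0 : 0 < s * a by rewrite mulr_gt0.
(* The loss 2 * eps * (1 + s * a) caused by octahedrality must not exceed
   s * eta; eps <= 1 keeps the factor 1 - eps nonnegative. *)
pose eps := Num.min 1 (s * eta / (2 * (1 + s * a))).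
have D0 : 0 < 2 * (1 + s * a) by lra.
have eps0 : 0 < eps by rewrite lt_min ltr01 divr_gt0// mulr_gt0.
have eps1 : eps <= 1 by rewrite ge_min lexx.
have loss : eps * (2 * (1 + s * a)) <= s * eta.
  by rewrite -ler_pdivlMr// ge_min lexx orbT.
have [u [u1 hu]] := octahedral_family hX (fun i => (z i).1) eps0.
have [v [v1 hv]] := octahedral_family hY (fun i => (z i).2) eps0.
pose w : psum p1 X Y := (a *: u, a *: v).
exists w; split.
  rewrite psum_normE /= !normrZ u1 v1 !mulr1 gtr0_norm// ap.
  by rewrite -[2^-1]div1r -splitr powR1.
move=> i.
have [hu1 hu2] := hu i _ sa0; have [hv1 hv2] := hv i _ sa0.
have hD : (1 - eps) * (1 + s * a) <= `|z i + s *: w|.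
  by apply: (pnorm_increment p1 (z1 i) (ltW sa0) eps1) => /=; rewrite scalerA.
have hB : (1 - eps) * (1 + s * a) <= `|z i - s *: w|.
  by apply: (pnorm_increment p1 (z1 i) (ltW sa0) eps1) => /=; rewrite scalerA.
apply: le_trans (lerD hD hB); clear -loss; clearbody eps; lra.
Qed.
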